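(* Let $ABC$ be a (non-degenerate) triangle in the Euclidean plane with $AC\neq AB$. Let $Z$ be the intersection of the perpendicular to $BC$ at $B$ with the perpendicular bisector of $AB$, and let $V$ be the intersection of the perpendicular to $BC$ at $C$ with the perpendicular bisector of $AC$. Let $\mathbb{F}$ be the pencil of conics touching the perpendicular bisector of $AB$ at $Z$ and the perpendicular bisector of $AC$ at $V$. Then every (non-degenerate) hyperbola or parabola in $\mathbb{F}$ is a curve from (1), (2) or (3) (as defined in the context) for some span $t$; in particular, for every point $E$ on such a hyperbola or parabola, the circle centered at $E$ passing through $A$ meets the line $BC$.
   Context: For a triangle $ABC$ with $AB\ne AC$ and $x\in\mathbb{R}$, $M_a(x)$ denotes the point on the segment $BC$ such that $BM_a(x):M_a(x)C=\left(\frac{AB}{AC}\right)^{x}$ (ratio of lengths). For $x\in\mathbb{R}$, $x\neq 0$, $M'_a(x)$ denotes the point on the line $BC$ not lying on the segment $BC$ such that $BM'_a(x):M'_a(x)C=\left(\frac{AB}{AC}\right)^{x}$ (ratio of lengths). A non-degenerate conic section $g$ is a curve - from (1) with span $t\in\mathbb{R}$, if for every $k\in\mathbb{R}$ the circumcenter of triangle $A\,M_a(k)\,M_a(k+t)$ lies on $g$; - from (2) with span $t\in\mathbb{R}$, if for every $k\in\mathbb{R}\setminus\{0,-t\}$ the circumcenter of triangle $A\,M'_a(k)\,M'_a(k+t)$ lies on $g$; - from (3) with span $t\in\mathbb{R}\setminus\{0\}$, if for every $k\in\mathbb{R}\setminus\{0\}$ the circumcenter of triangle $A\,M'_a(k)\,M_a(k+t)$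 lies on $g$. Convention for $t=0$: the two points on $BC$ coincide, and the ''circumcenter of the triangle $A\,M\,M$'' with $M$ on line $BC$ means the center of the circle through $A$ that is tangent to line $BC$ at $M$. *)

(* Defs.v *)
From HB Require Import structures.
From mathcomp Require Import all_boot all_order all_algebra.
From mathcomp Require Import boolp classical_sets reals exp.

Set Implicit Arguments.
Unset Strict Implicit.
Unset Printing Implicit Defensive.

Import Order.TTheory GRing.Theory Num.Theory.
Local Open Scope classical_set_scope.
Local Open Scope ring_scope.

Section EuclideanPlane.
Variable R : realType.
Local Notation point := 'rV[R]_2.
Implicit Types A B C E M N P Q S X Z V : point.
Implicit Types l m : set point.

Definition dot (u v : point) : R := (u *m v^T) 0 0.

(* The library norm on row vectors is the sup norm, hence this definition. *)
Definition dist P Q : R := Num.sqrt (dot (P - Q) (P - Q)).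

Definition nondegenerate_triangle A B C : Prop :=
  row_free (col_mx (B - A) (C - A)).

Definition line B C : set point :=
  [set X | exists s : R, X = (1 - s) *: B + s *: C].

Definition segment B C : set point :=
  [set X | exists2 s : R, 0 <= s <= 1 & X = (1 - s) *: B + s *: C].

(* the perpendicular to the line [B C] at [S] *)
Definition perpendicular B C S : set point :=
  [set X | dot (X - S) (C - B) = 0].

Definition perp_bisector A B : set point :=
  perpendicular A B (2^-1 *: (A + B)).

Definition circle E (r : R) : set point := [set X | dist X E = r].

(* [E] is the circumcenter of the triangle [A M N]; if [M = N] it is the center
   of the circle through [A] that is tangent to the line [l] at [M]. *)
Definition circumcenter l A M N E : Prop :=
  let c := circle E (dist E A) in
  [/\ c M, c N & M = N -> l `&` c = [set M]].

(* A conic a x^2 + 2 b x y + c y^2 + 2 d x + 2 e y + f = 0 is given by the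
   symmetric matrix [[a, b, d], [b, c, e], [d, e, f]], whose block
   [ulsubmx] is the matrix of the quadratic part. *)
Implicit Types g : 'M[R]_(2 + 1).

Definition conic_eval g P : R :=
  let p : 'rV[R]_(2 + 1) := row_mx P 1%:M in (p *m g *m p^T) 0 0.

Definition conic_points g : set point := [set P | conic_eval g P = 0].

Definition conic g : Prop := g^T = g /\ g != 0.

Definition nondegenerate_conic g : Prop := conic g /\ \det g != 0.

Definition hyperbola g : Prop :=
  nondegenerate_conic g /\ \det (ulsubmx g) < 0.

Definition parabola g : Prop :=
  nondegenerate_conic g /\ \det (ulsubmx g) = 0.

(* The equation of [g], restricted to [l], vanishes to order at least two at
   [P]; for a nondegenerate conic this says that [l] is its tangent at [P]. *)
Definition touches g l P : Prop :=
  l P /\ forall X, l X ->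
    exists c : R, forall s : R, conic_eval g (P + s *: (X - P)) = c * s ^+ 2.

Definition tangent_pencil l Z m V : set 'M[R]_(2 + 1) :=
  [set g | [/\ conic g, touches g l Z & touches g m V]].

(* [inner_point A B C x] holds of M_a(x) only, and [outer_point A B C x]
   of M'_a(x) only (for x != 0). *)
Definition inner_point A B C (x : R) : set point :=
  [set M | segment B C M /\ dist B M / dist M C = (dist A B / dist A C) `^ x].

Definition outer_point A B C (x : R) : set point :=
  [set M | (line B C `\` segment B C) M /\
           dist B M / dist M C = (dist A B / dist A C) `^ x].

(* some (in fact, the only) circumcenter of [A M N], with [M] and [N] the
   points singled out by [SM] and [SN], lies on [g] *)
Definition circumcenter_on A B C (SM SN : set point) g : Prop :=
  exists M N E, [/\ SM M, SN N, circumcenter (line B C) A M N E &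
                    conic_points g E].

Definition curve_from1 A B C g (t : R) : Prop :=
  nondegenerate_conic g /\
  forall k : R,
    circumcenter_on A B C (inner_point A B C k) (inner_point A B C (k + t)) g.

Definition curve_from2 A B C g (t : R) : Prop :=
  nondegenerate_conic g /\
  forall k : R, k != 0 -> k != - t ->
    circumcenter_on A B C (outer_point A B C k) (outer_point A B C (k + t)) g.

Definition curve_from3 A B C g (t : R) : Prop :=
  [/\ nondegenerate_conic g, t != 0 &
  forall k : R, k != 0 ->
    circumcenter_on A B C (outer_point A B C k) (inner_point A B C (k + t)) g].

End EuclideanPlane.

(* Main.v *)
Require Import Defs.
From mathcomp Require Import all_boot all_order all_algebra.
From mathcomp Require Import boolp classical_sets reals exp.
From mathcomp Require Import ring lra.
Import Order.TTheory GRing.Theory Num.Theory.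
Local Open Scope classical_set_scope.
Local Open Scope ring_scope.

(** Let [X s = (1 - s) B + s C], and let [power E s = |X s - E|^2 - |A - E|^2],
which vanishes exactly when the circle centered at [E] through [A] contains
[X s]. For fixed [s] it is affine in [E]; for fixed [E] it is a quadratic
polynomial in [s] with leading coefficient [a = |BC|^2]. With [W] the
circumcenter of [A B C], the points [Z], [W], [V] have the powers [a s^2],
[a s (s - 1)] and [a (1 - s)^2] (lemma [pencil_power_frame]). These three
polynomials are independent, so [Z], [W], [V] is an affine frame of the plane
([frame_full]). By affinity the point with barycentric coordinates
[(1 - s1) (1 - s2)], [s1 (1 - s2) + s2 (1 - s1)], [s1 s2] has the power
[a (s - s1) (s - s2)]: it is the circumcenter of [A], [X s1], [X s2], including
the tangent case [s1 = s2] ([circumcenter_of_roots]).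

The tangents [WZ] and [WV] are sides of the frame, so a conic of the pencil
reads [mu w^2 + 2 nu z v = 0] in barycentric coordinates ([conic_eval_frame]).
In terms of the signed ratios [rho_i = s_i / (1 - s_i)] this equation, at the
circumcenter of [A], [X s1], [X s2], becomes [mu (rho1 + rho2)^2 + 2 nu rho1
rho2 = 0], which only depends on the quotient [r = rho2 / rho1]. Nondegeneracy
means [mu, nu <> 0], and being a hyperbola or a parabola means [nu (nu + 2 mu)
>= 0] ([pencil_coefficients]); this is just the condition for a real root [r],
which is neither [0] nor [-1] ([pencil_ratio]). As [q = AB / AC <> 1], we can
write [r = q^t] or [r = - q^t]. In the first case the inner points with ratios
[q^k] and [q^(k + t)] form with [A] a triangle whose circumcenter is on the
conic, whence [curve_from1] with span [t]. In the second case the same holds of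
the outer point with signed ratio [- q^k] and the inner point with ratio [q^(k
+ t)], whence [curve_from3] with span [t], and [t <> 0] because [r <> -1].

Finally the discriminant of [power E] is [a^2 (w^2 - 4 z v)], and on the conic
[nu^2 (w^2 - 4 z v) = nu (nu + 2 mu) w^2 >= 0], so that the circle centered at
[E] through [A] meets [BC] ([frame_root]). *)

(** * Euclidean distances *)

Section Distances.
Set Implicit Arguments.
Unset Strict Implicit.
Variable R : realType.
Local Notation point := 'rV[R]_2.
Implicit Types (P Q : point) (u v : point).

Lemma dotE u v : dot u v = u 0 0 * v 0 0 + u 0 1 * v 0 1.
Proof.
rewrite /dot mxE !big_ord_recl big_ord0 addr0 !mxE.
by rewrite (_ : lift ord0 ord0 = 1)//; apply: val_inj.
Qed.

Lemma dot_ge0 u : 0 <= dot u u.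
Proof. by rewrite dotE -!expr2 addr_ge0 ?sqr_ge0. Qed.

Lemma dotZZ (k : R) u : dot (k *: u) (k *: u) = k ^+ 2 * dot u u.
Proof. by rewrite !dotE !mxE; ring. Qed.

Lemma dot_gt0 u : u != 0 -> 0 < dot u u.
Proof.
move=> u0; rewrite lt_neqAle dot_ge0 andbT eq_sym; apply: contra u0.
rewrite dotE -!expr2 paddr_eq0 ?sqr_ge0// !sqrf_eq0 => /andP[/eqP u00 /eqP u01].
apply/eqP/rowP; case=> -[|[|//]] i; rewrite !mxE.
  by rewrite -[RHS]u00; congr (u _ _); apply: val_inj.
by rewrite -[RHS]u01; congr (u _ _); apply: val_inj.
Qed.

Lemma dist_gt0 P Q : P != Q -> 0 < dist P Q.
Proof. by move=> PQ; rewrite sqrtr_gt0 dot_gt0// subr_eq0. Qed.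

End Distances.

(** * The polar form of a conic *)

Section Conics.
Set Implicit Arguments.
Unset Strict Implicit.
Variable R : realType.
Local Notation point := 'rV[R]_2.
Implicit Types (P Q S X d e : point) (u v w : 'rV[R]_(2 + 1)).
Implicit Types g : 'M[R]_(2 + 1).

Definition homog P : 'rV[R]_(2 + 1) := row_mx P 1%:M.

Definition polar g u v : R := (u *m g *m v^T) 0 0.

Lemma polarDl g u v w : polar g (u + v) w = polar g u w + polar g v w.
Proof. by rewrite /polar !mulmxDl mxE. Qed.

Lemma polarZl g (k : R) u w : polar g (k *: u) w = k * polar g u w.
Proof. by rewrite /polar -!scalemxAl mxE. Qed.

Lemma polarC g u v : g^T = g -> polar g u v = polar g v u.
Proof.
move=> gT; transitivity ((u *m g *m v^T)^T 0 0); first by rewrite mxE.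
by rewrite !trmx_mul trmxK gT mulmxA.
Qed.

Lemma polarDr g u v w : polar g w (u + v) = polar g w u + polar g w v.
Proof. by rewrite /polar linearD /= mulmxDr mxE. Qed.

Lemma polarZr g (k : R) u w : polar g w (k *: u) = k * polar g w u.
Proof. by rewrite /polar linearZ /= -scalemxAr mxE. Qed.

Lemma conic_evalE g P : conic_eval g P = polar g (homog P) (homog P).
Proof. by []. Qed.

Lemma homog_comb (x y z : R) P Q S : x + y + z = 1 ->
  homog (x *: P + y *: Q + z *: S) = x *: homog P + y *: homog Q + z *: homog S.
Proof.
move=> xyz; rewrite /homog !scale_row_mx !add_row_mx; congr row_mx.
by rewrite -!scalerDl xyz scale1r.
Qed.

(** Restricted to the line joining [P] to [X], the equation of [g] has constant
term [polar P P] and linear term [2 polar P X], up to a change of parameter;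
tangency at [P] kills both. *)
Lemma touches_polar g l P X : g^T = g -> touches g l P -> l X ->
  polar g (homog P) (homog P) = 0 /\ polar g (homog P) (homog X) = 0.
Proof.
move=> gT [_ tangent] lX; have [c gc] := tangent X lX.
have gPX s : (1 - s) ^+ 2 * polar g (homog P) (homog P) +
    2 * s * (1 - s) * polar g (homog P) (homog X) +
    s ^+ 2 * polar g (homog X) (homog X) = c * s ^+ 2.
  rewrite -gc (_ : P + _ = (1 - s) *: P + s *: X + 0 *: X); last first.
    by rewrite scale0r addr0 scalerBr scalerBl scale1r -addrA [- _ + _]addrC.
  rewrite conic_evalE homog_comb; last by ring.
  rewrite !(polarDl, polarDr, polarZl, polarZr) (polarC _ _ gT).
  by ring.
by have := gPX 0; have := gPX 1; have := gPX (-1); split; lra.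
Qed.

Lemma polar_eq0 g u : \det g != 0 -> (forall v, polar g u v = 0) -> u = 0.
Proof.
move=> detg uperp; have gu : g \in unitmx by rewrite unitmxE unitfE.
suff : u *m g = 0.
  by move=> /(congr1 (mulmx^~ (invmx g))); rewrite mulmxK// mul0mx.
apply/rowP => j; rewrite [RHS]mxE -(uperp (delta_mx 0 j)) /polar.
by rewrite trmx_delta -colE [RHS]mxE.
Qed.

Lemma polar_dir g d e :
  polar g (row_mx d 0) (row_mx e 0) = (d *m ulsubmx g *m e^T) 0 0.
Proof.
rewrite /polar -{1}[g]submxK mul_row_block tr_row_mx mul_row_col.
by rewrite !mul0mx !addr0 trmx0 mulmx0 addr0.
Qed.

Lemma quad2E (M : 'M[R]_2) d e : (d *m M *m e^T) 0 0 =
  d 0 0 * e 0 0 * M 0 0 + d 0 0 * e 0 1 * M 0 1 +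
  d 0 1 * e 0 0 * M 1 0 + d 0 1 * e 0 1 * M 1 1.
Proof.
rewrite !mxE !big_ord_recl !big_ord0 !mxE !big_ord_recl !big_ord0.
rewrite (_ : lift ord0 ord0 = 1); last exact: val_inj.
by ring.
Qed.

Lemma det2E (M : 'M[R]_2) : \det M = M 0 0 * M 1 1 - M 0 1 * M 1 0.
Proof.
rewrite (expand_det_row _ 0) !big_ord_recl big_ord0 /cofactor !det_mx11 !mxE.
rewrite (_ : lift ord0 ord0 = 1); last exact: val_inj.
rewrite (_ : lift 1 0 = 0); last exact: val_inj.
by rewrite /= !addr0 expr0 expr1; ring.
Qed.

(** The Gram determinant of [d] and [e] for the quadratic part of [g] is the
determinant of this quadratic part times the square of the determinant of [d]
and [e]. *)
Lemma gram_quadratic_part g d e : g^T = g -> \det (ulsubmx g) <= 0 ->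
  polar g (row_mx d 0) (row_mx d 0) * polar g (row_mx e 0) (row_mx e 0)
  <= polar g (row_mx d 0) (row_mx e 0) ^+ 2.
Proof.
move=> gT detg; rewrite -subr_ge0 !polar_dir !quad2E.
move: detg; rewrite det2E.
have -> : (ulsubmx g) 1 0 = (ulsubmx g) 0 1 by rewrite !mxE -{1}gT mxE.
move: ((ulsubmx g) 0 0) ((ulsubmx g) 0 1) ((ulsubmx g) 1 1) => p q r detg.
rewrite [leRHS](_ : _ = (d 0 0 * e 0 1 - d 0 1 * e 0 0) ^+ 2 * (q * q - p * r)).
  by rewrite mulr_ge0 ?sqr_ge0//; lra.
by ring.
Qed.

End Conics.

(** * Powers of the points of [BC] *)

Section Power.
Set Implicit Arguments.
Unset Strict Implicit.
Variable R : realType.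
Local Notation point := 'rV[R]_2.
Implicit Types (A B C E P Z W V : point).

Lemma triangle_free A B C (x y : R) : nondegenerate_triangle A B C ->
  x *: (B - A) + y *: (C - A) = 0 -> x = 0 /\ y = 0.
Proof.
move=> /row_freeP[D TD] xy0.
have : row_mx x%:M y%:M *m col_mx (B - A) (C - A) = 0.
  by rewrite mul_row_col !mul_scalar_mx.
move=> /(congr1 (mulmx^~ D)); rewrite -mulmxA TD mulmx1 mul0mx.
move=> /(congr1 (fun M : 'rV_(1 + 1) => (M 0 (lshift 1 0), M 0 (rshift 1 0)))).
by rewrite row_mxEl row_mxEr !mxE /= !mulr1n => -[-> ->].
Qed.

Lemma triangle_neq A B C : nondegenerate_triangle A B C ->
  [/\ A != B, A != C & B != C].
Proof.
move=> ABC; split; apply/eqP => e.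
- have [|/eqP] := @triangle_free A B C 1 0 ABC; last by rewrite oner_eq0.
  by rewrite e subrr scaler0 scale0r addr0.
- have [|_ /eqP] := @triangle_free A B C 0 1 ABC; last by rewrite oner_eq0.
  by rewrite e subrr scaler0 scale0r addr0.
- have [|/eqP] := @triangle_free A B C 1 (-1) ABC; last by rewrite oner_eq0.
  by rewrite e scale1r scaleN1r subrr.
Qed.

Lemma circumcenter_exists A B C : nondegenerate_triangle A B C ->
  exists W, perp_bisector A B W /\ perp_bisector A C W.
Proof.
move=> /row_freeP[D TD].
pose h P : R := dot (2^-1 *: (A + P)) (P - A).
pose W : point := (D *m col_mx (h B)%:M (h C)%:M)^T.
have : col_mx (B - A) (C - A) *m W^T = col_mx (h B)%:M (h C)%:M.
  by rewrite trmxK mulmxA TD mul1mx.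
rewrite mul_col_mx => /eq_col_mx[hB hC].
have dotW P : (P - A) *m W^T = (h P)%:M -> perp_bisector A P W.
  move=> /(congr1 (fun M : 'M_1 => M 0 0)); rewrite [RHS]mxE mulr1n -/(dot _ _).
  by rewrite /perp_bisector /perpendicular /= /h !dotE !mxE => hP; lra.
by exists W; split; apply: dotW.
Qed.

Definition base_point B C (s : R) : point := (1 - s) *: B + s *: C.

Lemma base_point_inj B C : B != C -> injective (base_point B C).
Proof.
move=> BC s t st.
have : (s - t) *: (C - B) = 0.
  apply/rowP => j; move/rowP: st => /(_ j); rewrite !mxE => st.
  by move: st; lra.
move/eqP; rewrite scaler_eq0 !subr_eq0 (eq_sym C) (negbTE BC) orbF.
by move/eqP.
Qed.

(** The power of [base_point B C s] with respect to the circle centered at [E]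
through [A]. *)
Definition power A B C E (s : R) : R :=
  dot (base_point B C s - E) (base_point B C s - E) - dot (A - E) (A - E).

Lemma power_circle A B C E s :
  circle E (dist E A) (base_point B C s) <-> power A B C E s = 0.
Proof.
have distC : dist E A = dist A E.
  by rewrite /dist -opprB -scaleN1r dotZZ sqrrN expr1n mul1r.
rewrite /circle /= distC /power; split=> [/eqP|/eqP].
  by rewrite eqr_sqrt ?dot_ge0// => /eqP->; rewrite subrr.
by rewrite subr_eq0 => /eqP h; rewrite /dist h.
Qed.

(** The factor [z + w + v] makes this usable twice: for barycentric coordinates,
of sum 1, and for linear relations between homogeneous coordinates, of sum 0. *)
Lemma power_lin A B C Z W V s (z w v : R) :
  z * power A B C Z s + w * power A B C W s + v * power A B C V s =
  (z + w + v) * (dot (base_point B C s) (base_point B C s) - dot A A)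
  - 2 * dot (base_point B C s - A) (z *: Z + w *: W + v *: V).
Proof. by rewrite /power !dotE !mxE; ring. Qed.

Lemma power_comb A B C Z W V s (z w v : R) : z + w + v = 1 ->
  power A B C (z *: Z + w *: W + v *: V) s =
  z * power A B C Z s + w * power A B C W s + v * power A B C V s.
Proof.
by move=> zwv; rewrite power_lin zwv /power !dotE !mxE; ring.
Qed.

Lemma power_bisectors A B C W s :
  perp_bisector A B W -> perp_bisector A C W ->
  power A B C W s = dot (C - B) (C - B) * (s * (s - 1)).
Proof.
rewrite /perp_bisector /perpendicular /= /power !dotE !mxE => hB hC.
apply/eqP; rewrite -subr_eq0; apply/eqP.
(* The difference is a combination of the equations [hB] and [hC]. *)
set x := (LHS); rewrite (_ : x = - (2 * (1 - s)) * 0 - (2 * s) * 0); last first.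
  by rewrite -{1}hB -hC /x; field.
by ring.
Qed.

Lemma power_tangent_left A B C Z s :
  perp_bisector A B Z -> perpendicular B C B Z ->
  power A B C Z s = dot (C - B) (C - B) * s ^+ 2.
Proof.
rewrite /perp_bisector /perpendicular /= /power !dotE !mxE => hB hC.
apply/eqP; rewrite -subr_eq0; apply/eqP.
set x := (LHS); rewrite (_ : x = - 2 * 0 - (2 * s) * 0); last first.
  by rewrite -{1}hB -hC /x; field.
by ring.
Qed.

Lemma power_tangent_right A B C V s :
  perp_bisector A C V -> perpendicular B C C V ->
  power A B C V s = dot (C - B) (C - B) * (1 - s) ^+ 2.
Proof.
rewrite /perp_bisector /perpendicular /= /power !dotE !mxE => hB hC.
apply/eqP; rewrite -subr_eq0; apply/eqP.
set x := (LHS); rewrite (_ : x = - 2 * 0 + (2 * (1 - s)) * 0); last first.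
  by rewrite -{1}hB -hC /x; field.
by ring.
Qed.

(** In other words, the circles centered at [Z], [W], [V] through [A] meet [BC]
in the pairs [{B, B}], [{B, C}], [{C, C}]. *)
Definition power_frame A B C Z W V := forall s,
  let a := dot (C - B) (C - B) in
  [/\ power A B C Z s = a * s ^+ 2, power A B C W s = a * (s * (s - 1)) &
      power A B C V s = a * (1 - s) ^+ 2].

Lemma pencil_power_frame A B C Z W V :
  perp_bisector A B Z -> perpendicular B C B Z ->
  perp_bisector A C V -> perpendicular B C C V ->
  perp_bisector A B W -> perp_bisector A C W ->
  power_frame A B C Z W V.
Proof.
by move=> ABZ BZ ACV CV ABW ACW s; split; [exact: power_tangent_left |
  exact: power_bisectors | exact: power_tangent_right].
Qed.

(** A linear relation between the homogeneous coordinates of [Z], [W], [V] is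
inherited by their powers, which are linearly independent polynomials. *)
Lemma frame_full A B C Z W V : B != C -> power_frame A B C Z W V ->
  forall u : 'rV[R]_(2 + 1), exists z w v,
    u = z *: homog Z + w *: homog W + v *: homog V.
Proof.
move=> BC frame.
have a0 : dot (C - B) (C - B) != 0.
  by rewrite gt_eqF// dot_gt0// subr_eq0 eq_sym.
pose F : 'M[R]_(1 + 1 + 1) :=
  col_mx (col_mx (homog Z) (homog W)) (homog V) : 'M[R]_(1 + 1 + 1, 2 + 1).
have coords (c : 'rV[R]_(1 + 1 + 1)) : exists z w v,
    c = row_mx (row_mx z%:M w%:M) v%:M /\
    c *m F = z *: homog Z + w *: homog W + v *: homog V.
  exists (lsubmx (lsubmx c) 0 0), (rsubmx (lsubmx c) 0 0), (rsubmx c 0 0).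
  have e : c = row_mx (row_mx (lsubmx (lsubmx c) 0 0)%:M
      (rsubmx (lsubmx c) 0 0)%:M) (rsubmx c 0 0)%:M.
    by rewrite -!mx11_scalar !hsubmxK.
  split=> //; rewrite {1}e /F.
  rewrite (mul_row_col (row_mx _ _)) (mul_row_col (_)%:M).
  by rewrite !mul_scalar_mx.
have Fu : F \in unitmx.
  rewrite -row_free_unit; apply/inj_row_free => c.
  have [z [w [v [-> ->]]]] := coords c.
  rewrite /homog !scale_row_mx !add_row_mx -row_mx0 => /eq_row_mx[comb0].
  rewrite !scalemx1 -!raddfD /= => /(congr1 (fun M : 'M_1 => M 0 0)).
  rewrite !mxE mulr1n => zwv0.
  have zero s : z * s ^+ 2 + w * (s * (s - 1)) + v * (1 - s) ^+ 2 = 0.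
    have := power_lin A B C Z W V s z w v.
    have [-> -> ->] := frame s.
    rewrite comb0 zwv0 mul0r [dot _ 0]dotE !mxE.
    rewrite !mulr0 addr0 mulr0 subr0 => h.
    by apply: (mulfI a0); rewrite mulr0 -h; ring.
  have -> : v = 0 by have := zero 0; lra.
  have -> : z = 0 by have := zero 1; have := zero 0; lra.
  have -> : w = 0 by have := zero (-1); have := zero 1; have := zero 0; lra.
  by rewrite !raddf0 !row_mx0.
move=> u; have [z [w [v [_ e]]]] := coords (u *m invmx F).
by exists z, w, v; rewrite -e mulmxKV.
Qed.

(** Comparing last components shows that homogeneous coordinates in the frame
are barycentric. *)
Lemma barycentric A B C Z W V E : B != C -> power_frame A B C Z W V ->
  exists z w v, z + w + v = 1 /\ E = z *: Z + w *: W + v *: V.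
Proof.
move=> BC frame; have [z [w [v]]] := frame_full BC frame (homog E).
rewrite /homog !scale_row_mx !add_row_mx => /eq_row_mx[EE].
rewrite !scalemx1 -!raddfD /= => /(congr1 (fun M : 'M_1 => M 0 0)).
by rewrite !mxE !mulr1n => zwv1; exists z, w, v.
Qed.

(** When [s1 = s2], the double root is the tangency demanded of the circle. *)
Lemma circumcenter_of_roots A B C E s1 s2 : B != C ->
  (forall s, power A B C E s = dot (C - B) (C - B) * ((s - s1) * (s - s2))) ->
  circumcenter (line B C) A (base_point B C s1) (base_point B C s2) E.
Proof.
move=> BC powE.
split; first by apply/power_circle; rewrite powE subrr mul0r mulr0.
  by apply/power_circle; rewrite powE subrr !mulr0.
move=> /(base_point_inj BC) s12; subst s2.
apply/seteqP; split=> [X [[s ->]]|X ->].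
  move=> /power_circle/eqP; rewrite powE mulf_eq0 gt_eqF/=; last first.
    by rewrite dot_gt0// subr_eq0 eq_sym.
  by rewrite mulf_eq0 orbb subr_eq0 => /eqP->.
split; first by exists s1.
by apply/power_circle; rewrite powE subrr mul0r mulr0.
Qed.

End Power.

(** * Points of [BC] of given ratio *)

Section Ratios.
Set Implicit Arguments.
Unset Strict Implicit.
Variable R : realType.
Implicit Types (A B C : 'rV[R]_2).

Lemma powR_onto (q r : R) : 0 < q -> q != 1 -> 0 < r -> exists t, r = q `^ t.
Proof.
move=> q0 q1 r0; exists (ln r / ln q).
by rewrite /powR gt_eqF// divfK ?ln_eq0// lnK.
Qed.

Lemma dist_base_point_ratio B C (s : R) : B != C ->
  dist B (base_point B C s) / dist (base_point B C s) C = `|s| / `|1 - s|.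
Proof.
move=> BC; have distZ (P Q : 'rV[R]_2) k : P - Q = k *: (C - B) ->
    dist P Q = `|k| * dist C B.
  by move=> e; rewrite /dist e dotZZ sqrtrM ?sqr_ge0// sqrtr_sqr.
rewrite (@distZ B _ (- s)); last first.
  by rewrite /base_point; apply/rowP => j; rewrite !mxE; ring.
rewrite (@distZ _ C (s - 1)); last first.
  by rewrite /base_point; apply/rowP => j; rewrite !mxE; ring.
rewrite normrN distrC -mulf_div divff ?mulr1//.
by rewrite gt_eqF// dist_gt0// eq_sym.
Qed.

Lemma inner_point_ratio A B C (x rho : R) : B != C ->
  0 < rho -> rho = (dist A B / dist A C) `^ x ->
  inner_point A B C x (base_point B C (rho / (1 + rho))).
Proof.
move=> BC rho0 rhoE; have rho1 : 0 < 1 + rho by lra.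
split.
  exists (rho / (1 + rho)) => //.
  by rewrite divr_ge0 ?(ltW rho0) ?(ltW rho1)//= ler_pdivrMr//; lra.
rewrite dist_base_point_ratio// -rhoE.
have -> : 1 - rho / (1 + rho) = (1 + rho)^-1 by field; lra.
rewrite normrM normfV (gtr0_norm rho0) (gtr0_norm rho1).
by field; lra.
Qed.

Lemma outer_point_ratio A B C (x rho : R) : B != C ->
  rho < 0 -> rho != -1 -> - rho = (dist A B / dist A C) `^ x ->
  outer_point A B C x (base_point B C (rho / (1 + rho))).
Proof.
move=> BC rho0 rhoN1 rhoE; have rho1 : 1 + rho != 0.
  by apply: contra rhoN1 => /eqP h; apply/eqP; lra.
split.
  split; first by exists (rho / (1 + rho)).
  move=> [s /andP[s0 s1] /(base_point_inj BC) sE].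
  have : s * (1 + rho) = rho by rewrite -sE; field.
  by nra.
rewrite dist_base_point_ratio// -rhoE.
have -> : 1 - rho / (1 + rho) = (1 + rho)^-1 by field.
rewrite normrM normfV (ltr0_norm rho0).
by field; rewrite normr_eq0.
Qed.

End Ratios.

(** * The conics of the pencil in the frame [Z], [W], [V] *)

Section Pencil.
Set Implicit Arguments.
Unset Strict Implicit.
Variable R : realType.
Implicit Types (A B C E P Q Z W V : 'rV[R]_2) (g : 'M[R]_(2 + 1)).

Lemma conic_eval_frame g Z W V (z w v : R) : g^T = g ->
  polar g (homog Z) (homog Z) = 0 -> polar g (homog V) (homog V) = 0 ->
  polar g (homog Z) (homog W) = 0 -> polar g (homog V) (homog W) = 0 ->
  z + w + v = 1 ->
  conic_eval g (z *: Z + w *: W + v *: V) =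
  polar g (homog W) (homog W) * w ^+ 2
  + 2 * polar g (homog Z) (homog V) * (z * v).
Proof.
move=> gT gZZ gVV gZW gVW zwv; rewrite conic_evalE homog_comb//.
rewrite !(polarDl, polarDr, polarZl, polarZr) gZZ gVV gZW gVW.
rewrite !(polarC (homog W) _ gT) gZW gVW (polarC (homog V) (homog Z) gT).
by ring.
Qed.

(** If [mu] or [nu] vanishes, then [W] or [Z] is conjugate to every point, and
[g] is degenerate. The inequality is [gram_quadratic_part] for the directions
[W - Z] and [V - W]. *)
Lemma pencil_coefficients g Z W V : g^T = g -> \det g != 0 ->
  \det (ulsubmx g) <= 0 ->
  polar g (homog Z) (homog Z) = 0 -> polar g (homog V) (homog V) = 0 ->
  polar g (homog Z) (homog W) = 0 -> polar g (homog V) (homog W) = 0 ->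
  (forall u : 'rV[R]_(2 + 1), exists z w v : R,
    u = z *: homog Z + w *: homog W + v *: homog V) ->
  let mu := polar g (homog W) (homog W) in
  let nu := polar g (homog Z) (homog V) in
  [/\ mu != 0, nu != 0 & 0 <= nu * (nu + 2 * mu)].
Proof.
move=> gT detg quadg gZZ gVV gZW gVW full mu nu.
have homog_neq0 P : homog P <> 0.
  rewrite /homog -row_mx0 => /eq_row_mx[_ /(congr1 (fun M : 'M_1 => M 0 0))].
  by rewrite !mxE mulr1n => /eqP; rewrite oner_eq0.
split.
- apply/eqP => mu0; apply: (homog_neq0 W); apply: (polar_eq0 detg) => u.
  have [z [w [v ->]]] := full u; rewrite !(polarDr, polarZr) -/mu mu0.
  by rewrite !(polarC (homog W) _ gT) gZW gVW !mulr0 !addr0.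
- apply/eqP => nu0; apply: (homog_neq0 Z); apply: (polar_eq0 detg) => u.
  have [z [w [v ->]]] := full u; rewrite !(polarDr, polarZr) -/nu nu0.
  by rewrite gZZ gZW !mulr0 !addr0.
have dirE P Q : row_mx (P - Q) 0 = homog P + (-1) *: homog Q.
  by rewrite scaleN1r /homog opp_row_mx add_row_mx subrr.
have := gram_quadratic_part (W - Z) (V - W) gT quadg.
rewrite !dirE !(polarDl, polarDr, polarZl, polarZr) gZZ gVV gZW gVW.
rewrite !(polarC (homog W) _ gT) gZW gVW.
by rewrite -/mu -/nu; nra.
Qed.

(** The discriminant of this equation in [r] is [4 nu (nu + 2 mu)]; its value at
[0] is [mu], and at [-1] it is [- 2 nu]. *)
Lemma pencil_ratio (mu nu : R) : mu != 0 -> nu != 0 ->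
  0 <= nu * (nu + 2 * mu) ->
  exists r, [/\ r != 0, r != -1 & mu * (1 + r) ^+ 2 + 2 * nu * r = 0].
Proof.
move=> mu0 nu0 disc; pose q := Num.sqrt (nu * (nu + 2 * mu)).
have qq : q ^+ 2 = nu * (nu + 2 * mu) by rewrite sqr_sqrtr.
pose r := (q - (mu + nu)) / mu.
have rE : mu * (1 + r) ^+ 2 + 2 * nu * r = 0.
  transitivity ((q ^+ 2 - nu * (nu + 2 * mu)) / mu); first by rewrite /r; field.
  by rewrite qq subrr mul0r.
exists r; split=> //; apply/eqP => r_eq; move: rE; rewrite r_eq.
  rewrite addr0 expr1n mulr1 mulr0 addr0 => h.
  by rewrite h eqxx in mu0.
by move=> h; move/eqP: nu0; apply; lra.
Qed.

(** As [z + w + v = 1], the polynomial is [s^2 - (w + 2 v) s + v], of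
discriminant [w^2 - 4 z v]; the equation of the conic makes [nu^2] times this
equal to [nu (nu + 2 mu) w^2]. *)
Lemma frame_root (mu nu z w v : R) : nu != 0 -> 0 <= nu * (nu + 2 * mu) ->
  z + w + v = 1 -> mu * w ^+ 2 + 2 * nu * (z * v) = 0 ->
  exists s, z * s ^+ 2 + w * (s * (s - 1)) + v * (1 - s) ^+ 2 = 0.
Proof.
move=> nu0 quad zwv gE.
have disc : 0 <= w ^+ 2 - 4 * (z * v).
  have nu2 : 0 < nu ^+ 2 by rewrite lt_neqAle sqr_ge0 andbT eq_sym sqrf_eq0.
  rewrite -(pmulr_rge0 _ nu2).
  rewrite [leRHS](_ : _ = nu * (nu + 2 * mu) * w ^+ 2
    - 2 * nu * (mu * w ^+ 2 + 2 * nu * (z * v))); last by ring.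
  by rewrite gE mulr0 subr0 mulr_ge0 ?sqr_ge0.
pose q := Num.sqrt (w ^+ 2 - 4 * (z * v)).
have qq : q ^+ 2 = w ^+ 2 - 4 * (z * v) by rewrite sqr_sqrtr.
exists ((w + 2 * v + q) / 2).
have zE : z = 1 - w - v by lra.
transitivity ((q ^+ 2 - (w ^+ 2 - 4 * (z * v))) / 4).
  by rewrite zE; field.
by rewrite qq subrr mul0r.
Qed.

(** With [s = rho / (1 + rho)], the barycentric coordinates of the circumcenter
are proportional to [1], [rho1 + rho2], [rho1 rho2]. *)
Lemma circumcenter_on_frame A B C Z W V g (mu nu rho1 rho2 : R)
    (SM SN : set 'rV[R]_2) :
  B != C -> power_frame A B C Z W V ->
  (forall z w v, z + w + v = 1 ->
     conic_eval g (z *: Z + w *: W + v *: V) =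
     mu * w ^+ 2 + 2 * nu * (z * v)) ->
  1 + rho1 != 0 -> 1 + rho2 != 0 ->
  mu * (rho1 + rho2) ^+ 2 + 2 * nu * (rho1 * rho2) = 0 ->
  SM (base_point B C (rho1 / (1 + rho1))) ->
  SN (base_point B C (rho2 / (1 + rho2))) ->
  circumcenter_on A B C SM SN g.
Proof.
move=> BC frame gE rho1N1 rho2N1 rhoE SM1 SN2.
set s1 := rho1 / _ in SM1; set s2 := rho2 / _ in SN2.
have sum1 : (1 - s1) * (1 - s2) + (s1 * (1 - s2) + s2 * (1 - s1)) + s1 * s2 = 1.
  by ring.
exists (base_point B C s1), (base_point B C s2),
  (((1 - s1) * (1 - s2)) *: Z + (s1 * (1 - s2) + s2 * (1 - s1)) *: W +
   (s1 * s2) *: V); split=> //.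
  apply: circumcenter_of_roots => // s.
  by rewrite power_comb//; have [-> -> ->] := frame s; ring.
rewrite /conic_points /= gE// /s1 /s2.
transitivity ((mu * (rho1 + rho2) ^+ 2 + 2 * nu * (rho1 * rho2)) /
  ((1 + rho1) * (1 + rho2)) ^+ 2).
  by field; apply/andP.
by rewrite rhoE mul0r.
Qed.

End Pencil.

(** * Hyperbolas and parabolas of the pencil *)

Theorem theorem2p2 (R : realType) (A B C Z V : 'rV[R]_2)
  (ABC : nondegenerate_triangle A B C)
  (AC_neq_AB : dist A C <> dist A B)
  (defZ : perpendicular B C B `&` perp_bisector A B = [set Z])
  (defV : perpendicular B C C `&` perp_bisector A C = [set V])
  (g : 'M[R]_(2 + 1))
  (g_pencil : tangent_pencil (perp_bisector A B) Z (perp_bisector A C) V g)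
  (g_type : hyperbola g \/ parabola g) :
  (exists t : R,
     curve_from1 A B C g t \/ curve_from2 A B C g t \/ curve_from3 A B C g t) /\
  (forall E : 'rV[R]_2, conic_points g E ->
     circle E (dist E A) `&` line B C !=set0).
Proof.
have [AB AC BC] := triangle_neq ABC.
have [BZ ABZ] : (perpendicular B C B `&` perp_bisector A B) Z by rewrite defZ.
have [CV ACV] : (perpendicular B C C `&` perp_bisector A C) V by rewrite defV.
have [W [ABW ACW]] := circumcenter_exists ABC.
have frame := pencil_power_frame ABZ BZ ACV CV ABW ACW.
have [[gT _] touchZ touchV] := g_pencil.
have [gZZ gZW] := touches_polar gT touchZ ABW.
have [gVV gVW] := touches_polar gT touchV ACW.
have nondeg : nondegenerate_conic g by case: g_type => -[].
have quadg : \det (ulsubmx g) <= 0.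
  by case: g_type => -[_ h]; [exact: ltW | rewrite h].
have full := frame_full BC frame.
have := pencil_coefficients gT nondeg.2 quadg gZZ gVV gZW gVW full.
have := fun z w v => @conic_eval_frame R g Z W V z w v gT gZZ gVV gZW gVW.
move: (polar g (homog W) _) (polar g (homog Z) _) => mu nu gE [mu0 nu0 quad].
split; last first.
  move=> E; have [z [w [v [zwv ->]]]] := barycentric E BC frame.
  rewrite /conic_points /= gE// => /(frame_root nu0 quad zwv)[s sE].
  exists (base_point B C s); split; last by exists s.
  apply/power_circle; rewrite power_comb//; have [-> -> ->] := frame s.
  by rewrite -[RHS](mulr0 (dot (C - B) (C - B))) -sE; ring.
have [r [r0 rN1 rE]] := pencil_ratio mu0 nu0 quad.
pose q := dist A B / dist A C.
have q0 : 0 < q by rewrite divr_gt0 ?dist_gt0.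
have q1 : q != 1.
  apply/eqP => q_eq1; apply: AC_neq_AB.
  exact/esym/divr1_eq.
have qD k t : q `^ (k + t) = q `^ k * q `^ t.
  by rewrite powRD// (gt_eqF q0) implybT.
have qk0 k : 0 < q `^ k by exact: powR_gt0.
have [r_lt0|r_gt0|r_eq0] := ltgtP r 0; last by rewrite r_eq0 eqxx in r0.
- have [t rt] : exists t, - r = q `^ t by apply: powR_onto; rewrite // oppr_gt0.
  exists t; right; right; split=> //.
    apply: contra rN1 => /eqP t0; apply/eqP.
    by rewrite -[LHS]opprK rt t0 powRr0.
  move=> k k0.
  have qk1 : q `^ k != 1 by rewrite powR_eq1 (negbTE q1) (negbTE k0) ltNge ltW.
  apply: (circumcenter_on_frame (rho1 := - q `^ k) (rho2 := q `^ (k + t)) BC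
    frame gE).
  + by rewrite subr_eq0 eq_sym.
  + by rewrite gt_eqF// addr_gt0.
  + rewrite qD -rt.
    transitivity ((q `^ k) ^+ 2 * (mu * (1 + r) ^+ 2 + 2 * nu * r)).
      by ring.
    by rewrite rE mulr0.
  + by apply: outer_point_ratio; rewrite ?oppr_lt0 ?eqr_opp ?opprK.
  + exact: inner_point_ratio.
have [t rt] := powR_onto q0 q1 r_gt0.
exists t; left; split=> // k.
apply: (circumcenter_on_frame (rho1 := q `^ k) (rho2 := q `^ (k + t)) BC
  frame gE).
- by rewrite gt_eqF// addr_gt0.
- by rewrite gt_eqF// addr_gt0.
- rewrite qD -rt.
  transitivity ((q `^ k) ^+ 2 * (mu * (1 + r) ^+ 2 + 2 * nu * r)).
    by ring.
  by rewrite rE mulr0.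
- exact: inner_point_ratio.
- exact: inner_point_ratio.
Qed.
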